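(* Let $X$ be an infinite set. The map $\mathcal{F} \mapsto \mathcal{C}_{\mathcal{F}}$ is an order isomorphism between the set of all filters on $X$ (including the improper filter $\mathcal{P}(X)$) and the set of all clones on $X$ containing $\mathcal{C}_3$ (both ordered by inclusion). In particular, the precomplete clones above $\mathcal{C}_3$ are exactly the clones of the form $\mathcal{C}_U$, where $U$ is an ultrafilter on $X$.
   Context: $\mathcal{O}^{(n)}$ is the set of all functions $X^n \to X$ ($n \ge 1$), and $\mathcal{O} = \bigcup_{n\ge 1} \mathcal{O}^{(n)}$ is the full clone. A clone on $X$ is a set $\mathcal{C} \subseteq \mathcal{O}$ which contains all projections and is closed under composition. The clones on $X$ form a complete lattice under inclusion with largest element $\mathcal{O}$; its coatoms (maximal elements among clones $\ne \mathcal{O}$) are called precomplete clones. For $f \in \mathcal{O}^{(n)}$ let $f^{(1)} \in \mathcal{O}^{(1)}$ be $f^{(1)}(x) = f(x, \ldots, x)$, and let $\mathrm{fix}(f) = \{x \in X : f^{(1)}(x) = x\}$. For a family $\mathcal{F} \subseteq \mathcal{P}(X)$, $\mathcal{C}_{\mathcal{F}} := \{f \in \mathcal{O} : \mathrm{fix}(f) \in \mathcal{F}\}$; if $\mathcal{F}$ is a filter then $\mathcal{C}_{\mathcal{F}}$ is a clone. $\mathcal{C}_3 := \mathcal{C}_{\{X\}}$ is the clone of idempotent functions, i.e. of all $f$ satisfying $f(x,\ldots,x) = x$ for all $x \in X$. A filter on $X$ is a nonempty family of subsets of $X$ closed under finite intersections and supersets; it is proper if it does not contain $\emptyset$. Ultrafilters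 are maximal proper filters (principal ones included). *)

(* Defs.v *)
From mathcomp Require Import all_boot.
From mathcomp Require Import boolp classical_sets functions cardinality filter.

Set Implicit Arguments.
Unset Strict Implicit.
Unset Printing Implicit Defensive.

Local Open Scope classical_set_scope.

(* Only arities n >= 1 are allowed, so the index n below stands for arity
   n.+1; operations of different arities are distinct by construction. *)
Definition nary (X : Type) (n : nat) : Type := ('I_n.+1 -> X) -> X.

Record operation (X : Type) : Type :=
  Operation { arity_pred : nat; op_fun : nary X arity_pred }.

Arguments op_fun {X} f _ : rename.

Definition projection (X : Type) (n : nat) (i : 'I_n.+1) : nary X n :=
  fun x => x i.

Definition composition (X : Type) (n m : nat)
    (f : nary X n) (g : 'I_n.+1 -> nary X m) : nary X m :=
  fun x => f (fun i => g i x).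

Definition is_clone (X : Type) (C : set (operation X)) : Prop :=
  (forall (n : nat) (i : 'I_n.+1), C (Operation (@projection X n i))) /\
  (forall (n m : nat) (f : nary X n) (g : 'I_n.+1 -> nary X m),
     C (Operation f) -> (forall i, C (Operation (g i))) ->
     C (Operation (composition f g))).

Definition precomplete (X : Type) (C : set (operation X)) : Prop :=
  [/\ is_clone C,
      C <> [set: operation X] &
      forall D : set (operation X),
        is_clone D -> D <> [set: operation X] -> C `<=` D -> D = C].

Definition diag (X : Type) (f : operation X) : X -> X := fun x => op_fun f (fun=> x).

Definition fix_set (X : Type) (f : operation X) : set X :=
  [set x | diag f x = x].

Definition clone_of (X : Type) (F : set_system X) : set (operation X) :=
  [set f | F (fix_set f)].

Definition idempotent_clone (X : Type) : set (operation X) :=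
  clone_of [set [set: X]].

Arguments idempotent_clone X _ : clear implicits.

(* Both sides are ordered by inclusion. *)
Definition order_isomorphism (S T : Type) (A : set (set S)) (B : set (set T))
    (phi : set S -> set T) : Prop :=
  set_bij A B phi /\
  (forall F G : set S, A F -> A G -> (F `<=` G <-> phi F `<=` phi G)).

(* Main.v *)
(* Every clone containing the idempotent operations is determined by the fixed
   point sets of its members.  If f is in C and fix f is a subset of fix g, then
   g(x_1, ..., x_n) = h(f(x_1, ..., x_1), x_1, ..., x_n), where h is g with its
   values on constant tuples replaced by the idempotent ones: the tuple
   (f(x_1, ..., x_1), x_1, ..., x_n) is constant only on fix f, where g agrees
   with the identity.  Since every subset of X is
   some fix g, the sets fix f with f in C form a filter F, and C = C_F. *)

Require Import Defs.
From mathcomp Require Import all_boot.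
From mathcomp Require Import boolp classical_sets functions cardinality filter.

Set Implicit Arguments.
Unset Strict Implicit.

Local Open Scope classical_set_scope.

Lemma fix_set_projection (X : Type) (n : nat) (i : 'I_n.+1) :
  fix_set (Operation (@projection X n i)) = [set: X].
Proof. by apply/seteqP; split. Qed.

(** A composition fixes every point fixed by [f] and by all the [g i]. As [i] ranges over a finite
    type, these points form a set of [F]. *)
Lemma clone_of_is_clone (X : Type) (F : set_system X) :
  Filter F -> is_clone (clone_of F).
Proof.
move=> FF; split=> [n i|n m f g Ff Fg].
  by rewrite /clone_of /= fix_set_projection; exact: filterT.
apply: (filterS _ (filterI Ff (filter_forall FF Fg))) => x [fx gx].
transitivity (f (fun=> x)); last exact: fx.
by congr f; apply/funext => i; exact: gx.
Qed.

Lemma idempotent_sub_clone_of (X : Type) (F : set_system X) :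
  Filter F -> idempotent_clone X `<=` clone_of F.
Proof.
move=> FF f fT; have fE : fix_set f = [set: X] := fT.
by rewrite /clone_of /= fE; exact: filterT.
Qed.

(** This is the form in which infinity of [X] is used: every point can be moved. *)
Lemma infinite_exists_neq (X : Type) :
  infinite_set [set: X] -> forall x : X, exists y, y <> x.
Proof.
move=> Xinf x; apply: contrapT => H; apply: Xinf.
suff -> : [set: X] = [set x] by exact: finite_set1.
apply/seteqP; split=> // y _ /=.
by apply: contrapT => yx; apply: H; exists y.
Qed.

(** A unary operation suffices: the identity on [A], and off [A] a choice function [s] that moves
    every point. *)
Lemma fix_set_surj (X : Type) (A : set X) :
  (forall x : X, exists y, y <> x) -> exists f : operation X, fix_set f = A.
Proof.
move=> /choice[s sx].
exists (@Operation X 0 (fun x => if `[< A (x ord0) >] then x ord0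
                                 else s (x ord0))).
apply/seteqP; split=> x; rewrite /fix_set /diag /=; case: asboolP => //.
by move=> _ /sx.
Qed.

Lemma clone_of_le (X : Type) (F G : set_system X) :
  (forall x : X, exists y, y <> x) ->
  F `<=` G <-> clone_of F `<=` clone_of G.
Proof.
move=> X2; split=> [FG f|CFG A FA]; first exact: FG.
by have [f fA] := fix_set_surj A X2; rewrite -fA; apply: CFG; rewrite /clone_of /= fA.
Qed.

Section clone_above_idempotent.
Variables (X : Type) (C : set (operation X)).
Hypotheses (Cclone : is_clone C) (Cidem : idempotent_clone X `<=` C).

Lemma idempotent_mem (n : nat) (h : nary X n) :
  (forall x, h (fun=> x) = x) -> C (Operation h).
Proof. by move=> hx; apply: Cidem; apply/seteqP; split=> x // _; exact: hx. Qed.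

(** The arity [n] is free so that the diagonal of [f] can serve as an inner function in compositions
    of any arity. *)
Lemma diag_mem (f : operation X) (n : nat) :
  C f -> C (@Operation X n (fun x => diag f (x ord0))).
Proof.
case: f => m f Cf; apply: (proj2 Cclone _ _ f (fun=> projection ord0)) => // _.
exact: (proj1 Cclone).
Qed.

Lemma fix_set_mem (f g : operation X) :
  C f -> fix_set f `<=` fix_set g -> C g.
Proof.
case: g => n g Cf fg.
pose h : nary X n.+1 := fun y =>
  if `[< forall i, y i = y ord0 >] then y ord0 else g (fun j => y (lift ord0 j)).
pose a : 'I_n.+2 -> nary X n := fun i =>
  if unlift ord0 i is Some j then projection j else fun x => diag f (x ord0).
suff -> : g = composition h a.
  apply: (proj2 Cclone).
    by apply: idempotent_mem => x; rewrite /h; case: asboolP.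
  move=> i; rewrite /a; case: unlift => [j|]; first exact: (proj1 Cclone).
  exact: diag_mem.
have a0 x : a ord0 x = diag f (x ord0) by rewrite /a unlift_none.
have aS j x : a (lift ord0 j) x = x j by rewrite /a liftK.
apply/funext => x; rewrite /composition /h; case: asboolP => [xC|_]; last first.
  by congr g; apply/funext => j; rewrite aS.
have xE j : x j = diag f (x ord0) by have := xC (lift ord0 j); rewrite aS a0.
have xcst : x = (fun=> x ord0) by apply/funext => j; rewrite (xE j) -(xE ord0).
rewrite a0 -(xE ord0) {1}xcst; apply: (fg (x ord0)).
exact: esym (xE ord0).
Qed.

(** Take k(x) = h(x, f(x,...,x), g(x,...,x)), where the idempotent [h] passes on its third argument
    if the first two agree and its second otherwise. If [f] moves x then so does k; if [f] fixes x
    then k acts as [g]. *)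
Lemma fix_set_setI (f g : operation X) : C f -> C g ->
  exists2 k, C k & fix_set k = fix_set f `&` fix_set g.
Proof.
move=> Cf Cg.
pose h : nary X 2 := fun y =>
  if `[< y (inord 1) = y ord0 >] then y (inord 2) else y (inord 1).
(* The default of [nth] is never reached, since the index is below 3. *)
pose a : 'I_3 -> nary X 0 := fun i =>
  nth (projection ord0)
    [:: projection ord0; fun x => diag f (x ord0); fun x => diag g (x ord0)] i.
exists (Operation (composition h a)).
  apply: (proj2 Cclone).
    by apply: idempotent_mem => x; rewrite /h; case: asboolP.
  case=> -[|[|[|i]]] // i3; rewrite /a /=; [exact: (proj1 Cclone)|exact: diag_mem..].
rewrite /fix_set /diag /= /composition /h /a !inordK //= /projection /diag.
by apply/seteqP; split=> x /=; case: asboolP => // fx; case.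
Qed.

Lemma fix_sets_filter : (forall x : X, exists y, y <> x) ->
  Filter [set fix_set f | f in C].
Proof.
move=> X2; split.
- exists (Operation (@projection X 0 ord0)); first exact: (proj1 Cclone).
  exact: fix_set_projection.
- move=> _ _ [f Cf <-] [g Cg <-].
  by have [k Ck kE] := fix_set_setI Cf Cg; exists k.
- move=> A B AB [f Cf fA]; move: AB; rewrite -fA.
  (* The superset [B] is itself realised as the fixed point set of some [g], which [fix_set_mem]
     then puts in [C]. *)
  have [g <-] := fix_set_surj B X2 => fg.
  by exists g => //; exact: fix_set_mem fg.
Qed.

Lemma clone_of_fix_sets : clone_of [set fix_set f | f in C] = C.
Proof.
apply/seteqP; split=> f; last by move=> Cf; exists f.
by case=> g Cg gf; apply: fix_set_mem Cg _; rewrite gf.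
Qed.

End clone_above_idempotent.

Lemma clone_ofP (X : Type) (C : set (operation X)) :
  (forall x : X, exists y, y <> x) ->
  is_clone C /\ idempotent_clone X `<=` C <->
  exists2 F, Filter F & C = clone_of F.
Proof.
move=> X2; split=> [[Cc Ci]|[F FF ->]].
  exists [set fix_set f | f in C]; first exact: fix_sets_filter.
  by rewrite clone_of_fix_sets.
by split; [exact: clone_of_is_clone|exact: idempotent_sub_clone_of].
Qed.

(** Some operation has no fixed point, so the full clone forces the empty set into [F]. *)
Lemma clone_of_eqT (X : Type) (F : set_system X) :
  Filter F -> (forall x : X, exists y, y <> x) ->
  clone_of F = [set: operation X] <-> F set0.
Proof.
move=> FF X2; split=> [FT|F0].
  have [f f0] := fix_set_surj set0 X2.
  by rewrite -f0; have : clone_of F f by rewrite FT.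
by apply/seteqP; split=> // f _; apply: filterS F0.
Qed.

Lemma precomplete_clone_of (X : Type) (F : set_system X) :
  Filter F -> (forall x : X, exists y, y <> x) ->
  precomplete (clone_of F) <-> UltraFilter F.
Proof.
move=> FF X2; split=> [[_ FT Fmax]|UF].
  have PF : ProperFilter F.
    by split=> // F0; apply: FT; apply/clone_of_eqT.
  (* A proper filter [G] above [F] yields a proper clone above [clone_of F]. Maximality makes the
     two clones equal, and reflecting the inclusion gives [G] inside [F]. *)
  split=> // G PG FG; apply/seteqP; split=> //; apply/(clone_of_le _ _ X2).
  rewrite (Fmax (clone_of G)) //; first exact: clone_of_is_clone.
    by move/clone_of_eqT => /(_ X2); exact: filter_not_empty.
  exact/clone_of_le.
split; first exact: clone_of_is_clone.
  by move/clone_of_eqT => /(_ X2); exact: filter_not_empty.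
move=> D Dc DT FD.
(* Lying above [clone_of F], the clone [D] contains all idempotent operations, so it comes from a
   filter and maximality of [F] applies. *)
have [G FG DE] : exists2 G, Filter G & D = clone_of G.
  apply/clone_ofP => //; split=> //.
  exact: subset_trans (idempotent_sub_clone_of FF) FD.
subst D; congr clone_of; apply: max_filter; last exact/clone_of_le.
by split=> // G0; apply: DT; apply/clone_of_eqT.
Qed.

Theorem theorem3p6 (X : Type) (Xinf : infinite_set [set: X]) :
  order_isomorphism
    [set F : set_system X | Filter F]
    [set C : set (operation X) | is_clone C /\ idempotent_clone X `<=` C]
    (@clone_of X) /\
  (forall C : set (operation X),
     (precomplete C /\ idempotent_clone X `<=` C) <->
     (exists2 U : set_system X, UltraFilter U & C = clone_of U)).
Proof.
have X2 := infinite_exists_neq Xinf.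
split.
  split; last by move=> F G _ _; exact: clone_of_le.
  split.
  - by move=> F FF; apply/clone_ofP => //; exists F.
  (* Injectivity follows from reflecting the order in both directions. *)
  - move=> F G _ _ FG; apply/seteqP.
    by split; apply/(clone_of_le _ _ X2); rewrite FG.
  - by move=> C /(clone_ofP _ X2)[F FF ->]; exists F.
move=> C; split=> [[Cp Ci]|[U UF ->]].
  have [Cc _ _] := Cp.
  have [F FF CE] := (clone_ofP C X2).1 (conj Cc Ci).
  by exists F => //; apply/precomplete_clone_of; rewrite // -CE.
by split; [exact/precomplete_clone_of|exact: idempotent_sub_clone_of].
Qed.
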